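(* Let $n=2^d$ with $d\ge 1$ an integer, and let $H_n$ be the Sylvester (Walsh--Hadamard) matrix of order $n$. After sign/permutation normalisation (so that the first column is $\mathbf 1$), the matrix $Q=H_n/\sqrt n$ is orthogonal with first column $\mathbf 1/\sqrt n$ and all entries equal to $\pm 1/\sqrt n$, hence $M(Q)=1$. Therefore, for every Suleĭmanova spectrum $(1,\lambda_2,\dots,\lambda_n)$ with $1+\sum_{j=2}^n\lambda_j>0$, the matrix $Q\Lambda Q^{\top}$, where $\Lambda=\operatorname{diag}(1,\lambda_2,\dots,\lambda_n)$, is symmetric and doubly stochastic.
   Context: $\mathbf 1$ denotes the all-ones vector. A real square matrix is doubly stochastic if its entries are non-negative and all its row sums and column sums equal $1$. A Suleĭmanova spectrum is a list $(1,\lambda_2,\dots,\lambda_n)$ with $\lambda_j\in[-1,0]$ for $j\ge 2$ (not necessarily sorted). The Sylvester (Walsh--Hadamard) matrix of order $n=2^d$ has rows and columns indexed by $G=(\mathbb Z/2\mathbb Z)^d$ (in lexicographic order), with entry $(-1)^{\mathbf a\cdot\mathbf x}=(-1)^{\sum_{i=1}^d a_ix_i}$ at row $\mathbf a$ and column $\mathbf x$; equivalently $H_1=(1)$ and $H_{2m}=\begin{pmatrix}H_m&H_m\\H_m&-H_m\end{pmatrix}$. For a real orthogonal $n\times n$ matrix $Q=[q_0,\dots,q_{n-1}]$ with first column $q_0=\mathbf 1/\sqrt n$, the coherence is \[ M(Q):=\sup_{1\le j\le n-1}\ \sup_{0\le k,l\le n-1}n\,|q_j(k)q_j(l)|=n\max_{1\le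 j\le n-1}\|q_j\|_\infty^2 . \] *)

(* Defs.v *)
From HB Require Import structures.
From mathcomp Require Import all_boot all_order all_fingroup all_algebra.
From mathcomp Require Import all_classical all_reals.

Set Implicit Arguments.
Unset Strict Implicit.
Unset Printing Implicit Defensive.

Import Order.TTheory GRing.Theory Num.Theory.

Local Open Scope classical_set_scope.
Local Open Scope ring_scope.

(* The k-th element (k < 2 ^ d) of (Z/2Z)^d in lexicographic order: its
   coordinates are the binary digits of k, most significant first. *)
Definition lex_elt (d k : nat) : 'rV['Z_2]_d :=
  \row_(i < d) (k %/ 2 ^ (d - i.+1))%:R.

Definition sylvester (R : realType) (d : nat) : 'M[R]_(2 ^ d)%N :=
  \matrix_(a, x)
    (-1) ^+ (\sum_(i < d) (lex_elt d a 0%R i : nat) * (lex_elt d x 0%R i : nat))%N.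

(* K arises from H by permuting and changing the signs of rows and columns, and
   its first column is the all-ones vector. *)
Definition normalisation_of (R : realType) (n : nat) (H K : 'M[R]_n) : Prop :=
  (exists (s t : 'S_n) (e f : 'I_n -> bool),
      K = \matrix_(i, j) ((-1) ^+ e i * (-1) ^+ f j * H (s i) (t j))) /\
  (forall i j : 'I_n, j = 0%N :> nat -> K i j = 1).

Definition orthogonal_matrix (R : realType) (n : nat) (Q : 'M[R]_n) : Prop :=
  Q^T *m Q = 1%:M.

(* The column q_j has entries q_j(k) = Q k j.  For n >= 2 both suprema are over
   non-empty finite sets; [sup] takes the junk value 0 on the empty set. *)
Definition coherence (R : realType) (n : nat) (Q : 'M[R]_n) : R :=
  sup [set sup [set n%:R * `|Q kl.1 j * Q kl.2 j| | kl in [set: 'I_n * 'I_n]]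
      | j in [set j : 'I_n | (0 < j)%N]].

Definition doubly_stochastic (R : realType) (n : nat) (A : 'M[R]_n) : Prop :=
  [/\ forall i j, 0 <= A i j,
      forall i, \sum_j A i j = 1
    & forall j, \sum_i A i j = 1].

(* The list (1, lambda_2, ..., lambda_n) is the row vector lam, with 0-based
   indices. *)
Definition suleimanova (R : realType) (n : nat) (lam : 'rV[R]_n) : Prop :=
  (forall j : 'I_n, j = 0%N :> nat -> lam 0 j = 1) /\
  (forall j : 'I_n, (0 < j)%N -> -1 <= lam 0 j <= 0).

(* Main.v *)
Require Import Defs.
From HB Require Import structures.
From mathcomp Require Import all_boot all_order all_fingroup all_algebra.
From mathcomp Require Import all_classical all_reals.

Set Implicit Arguments.
Unset Strict Implicit.
Unset Printing Implicit Defensive.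

Import Order.TTheory GRing.Theory Num.Theory.

Local Open Scope ring_scope.

(** The rows and columns of the Sylvester matrix are the characters
    [walsh a] of the group $(\mathbb Z/2)^d$, and its column orthogonality is
    the orthogonality of characters: the product of the columns [x] and [y] is
    the column [x + y] ([walshDr]), and a character which takes the value $-1$
    sums to zero over the group, because translating by a point where it is
    $-1$ turns the sum into its opposite ([sum_walsh_eq0]).  Permutations and
    sign changes of rows and columns preserve this, so that
    $H^\top H = n I$ for every normalisation $H$ ([normalisation_orthogonal]).

    All entries of $Q = H/\sqrt n$ have modulus $1/\sqrt n$, which makes every
    number in the two suprema defining the coherence equal to $1$.
    For $A = Q \Lambda Q^\top$ the row sums are $1$ because $\mathbf 1$ is
    $\sqrt n$ times the first column of $Q$, hence an eigenvector of $A$ with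
    eigenvalue $\lambda_1 = 1$ ([row_sum_spectral]).  The entries of $A$ are
    $\frac1n \sum_k \pm\lambda_k$ where the sign at $k = 1$ is $+$; since the
    other $\lambda_k$ are nonpositive, the worst choice of signs is all $+$,
    which gives $\frac1n(1 + \sum_{k \ge 2} \lambda_k) \ge 0$
    ([spectral_ge0]). *)

(** * Binary digits and the lexicographic enumeration *)

Lemma binary_digits_inj (d k l : nat) : (k < 2 ^ d)%N -> (l < 2 ^ d)%N ->
  (forall j, (j < d)%N -> (k %/ 2 ^ j) %% 2 = (l %/ 2 ^ j) %% 2)%N -> k = l.
Proof.
elim: d k l => [|d IHd] k l; first by case: k; case: l.
rewrite expnSr => ltk ltl eq_digits.
have eq_half : (k %/ 2 = l %/ 2)%N.
  apply: IHd; rewrite ?ltn_divLR // => j ltjd.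
  by rewrite -!divnMA -!expnS eq_digits.
have := eq_digits 0 (ltn0Sn d); rewrite expn0 !divn1 => eq_mod.
by rewrite (divn_eq k 2) (divn_eq l 2) eq_half eq_mod.
Qed.

Lemma lex_elt_inj (d : nat) : injective (fun k : 'I_(2 ^ d) => lex_elt d k).
Proof.
move=> k l eq_kl; apply/val_inj.
apply: (@binary_digits_inj d); rewrite ?ltn_ord // => j ltjd.
(* The most significant digit comes first, so the digit of weight 2 ^ j is
   the coordinate d - 1 - j. *)
have := congr1 (fun v : 'rV['Z_2]_d => v 0 (rev_ord (Ordinal ltjd)) : nat) eq_kl.
by rewrite !mxE !val_Zp_nat //= -subSn // subSS subKn // ltnW.
Qed.

Lemma lex_elt_bij (d : nat) : bijective (fun k : 'I_(2 ^ d) => lex_elt d k).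
Proof.
apply: inj_card_bij; first exact: lex_elt_inj.
by rewrite card_mx mul1n !card_ord.
Qed.

Lemma lex_elt0 (d : nat) : lex_elt d 0 = 0.
Proof. by apply/rowP => i; rewrite !mxE div0n. Qed.

(** * Characters of the elementary abelian 2-group *)

Definition walsh (R : pzRingType) (d : nat) (a x : 'rV['Z_2]_d) : R :=
  (-1) ^+ (\sum_(i < d) (a 0%R i : nat) * (x 0%R i : nat))%N.

Lemma sylvesterE (R : realType) (d : nat) (a x : 'I_(2 ^ d)) :
  sylvester R d a x = walsh R (lex_elt d a) (lex_elt d x).
Proof. by rewrite mxE. Qed.

Lemma walshC (R : pzRingType) (d : nat) (a x : 'rV['Z_2]_d) :
  walsh R a x = walsh R x a.
Proof. by rewrite /walsh; under eq_bigr do rewrite mulnC. Qed.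

Lemma walshDr (R : pzRingType) (d : nat) (a x y : 'rV['Z_2]_d) :
  walsh R a (x + y) = walsh R a x * walsh R a y.
Proof.
rewrite /walsh -exprD -signr_odd -[RHS]signr_odd -big_split /=.
congr (_ ^+ nat_of_bool _); apply: (big_ind2 (fun m n => odd m = odd n)) => //.
  by move=> m1 m2 n1 n2 eq_m eq_n; rewrite !oddD eq_m eq_n.
by move=> i _; rewrite -mulnDr !oddM mxE /= oddD modn2 oddb oddD.
Qed.

Lemma walshDl (R : pzRingType) (d : nat) (a b x : 'rV['Z_2]_d) :
  walsh R (a + b) x = walsh R a x * walsh R b x.
Proof. by rewrite walshC walshDr !(walshC R x). Qed.

Lemma walsh0r (R : pzRingType) (d : nat) (a : 'rV['Z_2]_d) : walsh R a 0 = 1.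
Proof. by rewrite /walsh big1 // => i _; rewrite mxE muln0. Qed.

Lemma walsh_delta (R : pzRingType) (d : nat) (i : 'I_d) (x : 'rV['Z_2]_d) :
  walsh R (delta_mx 0 i) x = (-1) ^+ (x 0 i : nat).
Proof.
rewrite /walsh (bigD1 i) //= mxE !eqxx mul1n big1 ?addn0 // => j neq_ji.
by rewrite mxE (negbTE neq_ji) andbF.
Qed.

(** The duality is nondegenerate: a nonzero coordinate $x_i$ makes the
    character $-1$ at the $i$-th basis vector, and translating by that vector
    shows that the sum equals its own opposite. *)
Lemma sum_walsh_eq0 (R : numDomainType) (d : nat) (x : 'rV['Z_2]_d) :
  x != 0 -> \sum_a walsh R a x = 0.
Proof.
case/rV0Pn=> i nz_xi; set S := \sum_a _.
have xi1 : x 0 i = 1 :> nat by case: (x 0 i) nz_xi => [[|[|]]].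
have SN : S = - S.
  rewrite {1}/S (reindex_inj (addrI (delta_mx 0 i))) /=.
  under eq_bigr do rewrite walshDl walsh_delta xi1 mulN1r.
  exact: sumrN.
by apply/eqP; rewrite -eqNr -SN.
Qed.

Lemma addr_eq0_Z2 (d : nat) (x y : 'rV['Z_2]_d) : (x + y == 0) = (x == y).
Proof.
have Ny : - y = y by apply/rowP => i; rewrite mxE; case: (y 0 i) => [[|[|]]] // ?;
  apply/val_inj.
by rewrite -{1}Ny subr_eq0.
Qed.

Lemma sum_walshM (R : numDomainType) (d : nat) (x y : 'rV['Z_2]_d) :
  \sum_a walsh R a x * walsh R a y = (2 ^ d)%:R *+ (x == y).
Proof.
under eq_bigr do rewrite -walshDr.
have [->|neq_xy] := eqVneq x y; last by rewrite sum_walsh_eq0 // addr_eq0_Z2.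
have /eqP -> : y + y == 0 by rewrite addr_eq0_Z2.
under eq_bigr do rewrite walsh0r.
by rewrite sumr_const card_mx mul1n card_ord.
Qed.

(** * The Sylvester matrix and its normalisations *)

Lemma sylvester_orthogonal (R : realType) (d : nat) :
  (sylvester R d)^T *m sylvester R d = ((2 ^ d)%:R)%:M.
Proof.
apply/matrixP => x y; rewrite !mxE -(inj_eq (@lex_elt_inj d)) -sum_walshM.
rewrite [RHS](reindex _ (onW_bij _ (lex_elt_bij d))).
by apply: eq_bigr => a _; rewrite mxE !sylvesterE.
Qed.

Lemma sylvester_normalised (R : realType) (d : nat) :
  normalisation_of (sylvester R d) (sylvester R d).
Proof.
split; last by move=> i j j0; rewrite sylvesterE j0 lex_elt0 walsh0r.
exists 1%g, 1%g, (fun=> false), (fun=> false).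
by apply/matrixP => i j; rewrite [RHS]mxE !perm1 !mul1r.
Qed.

(** In $K^\top K$ the row signs occur squared and the row permutation only
    reorders each sum; the column signs conjugate a scalar matrix by a diagonal
    sign matrix, which fixes it. *)
Lemma normalisation_orthogonal (R : realType) (n : nat) (c : R)
    (H K : 'M[R]_n) :
  normalisation_of H K -> H^T *m H = c%:M -> K^T *m K = c%:M.
Proof.
case=> [[s [t [e [f ->]]]] _] /matrixP orthH; apply/matrixP => i j.
rewrite !mxE; have := orthH (t i) (t j); rewrite !mxE (inj_eq perm_inj).
rewrite (reindex_inj (@perm_inj _ s)) /= => sumH.
transitivity ((-1) ^+ f i * (-1) ^+ f j * (c *+ (i == j))).
  rewrite -sumH mulr_sumr; apply: eq_bigr => k _; rewrite !mxE.
  rewrite mulrACA [X in X * _]mulrACA.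
  by rewrite -[(-1) ^+ e k * _]signr_addb addbb mul1r.
case: eqP => [->|_]; last by rewrite !mulr0n mulr0.
by rewrite -signr_addb addbb mul1r.
Qed.

Lemma normalisation_norm1 (R : realType) (d : nat) (H : 'M[R]_(2 ^ d)) :
  normalisation_of (sylvester R d) H -> forall i j, `|H i j| = 1.
Proof.
by case=> [[s [t [e [f ->]]]] _] i j; rewrite !mxE !normrM !normr_sign !mul1r.
Qed.

(** * Flat orthogonal matrices *)

(** With $|Q_{kj}|^2 = 1/n$ throughout, both suprema range over the
    one-element set $\{1\}$; a column other than the first exists as
    $n \ge 2$. *)
Lemma coherence_flat (R : realType) (n : nat) (Q : 'M[R]_n) : (1 < n)%N ->
  (forall i j, `|Q i j| = (Num.sqrt n%:R)^-1) -> coherence Q = 1.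
Proof.
move=> n_gt1 normQ; have n_gt0 : (0 < n)%N by apply: ltnW.
have one k l j : n%:R * `|Q k j * Q l j| = 1.
  rewrite normrM !normQ -invfM -expr2 sqr_sqrtr ?ler0n // divff //.
  by rewrite pnatr_eq0 -lt0n.
have inner (j : 'I_n) : [set n%:R * `|Q kl.1 j * Q kl.2 j|
    | kl in [set: 'I_n * 'I_n]]%classic = [set 1]%classic.
  apply/seteqP; split=> [_ [kl _ <-]|_ ->]; first exact: one.
  by exists (Ordinal n_gt0, Ordinal n_gt0) => //=; rewrite one.
rewrite /coherence; under eq_imagel do rewrite inner sup1.
have -> : [set (1 : R) | j in [set j : 'I_n | (0 < j)%N]]%classic = [set 1]%classic.
  apply/seteqP; split=> [_ [j _ <-] //|_ ->].
  by exists (Ordinal n_gt1).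
exact: sup1.
Qed.

Lemma spectral_sym (R : comPzRingType) (n : nat) (Q : 'M[R]_n) (lam : 'rV[R]_n) :
  (Q *m diag_mx lam *m Q^T)^T = Q *m diag_mx lam *m Q^T.
Proof. by rewrite !trmx_mul trmxK tr_diag_mx mulmxA. Qed.

Lemma spectralE (R : comPzRingType) (n : nat) (Q : 'M[R]_n) (lam : 'rV[R]_n) i j :
  (Q *m diag_mx lam *m Q^T) i j = \sum_k Q i k * Q j k * lam 0 k.
Proof.
by rewrite mxE; apply: eq_bigr => k _; rewrite mul_mx_diag !mxE mulrAC.
Qed.

(** The vector $\mathbf 1$ is a multiple of the column [i0], so that it is an
    eigenvector with eigenvalue [lam 0 i0]. *)
Lemma row_sum_spectral (R : realType) (n : nat) (Q : 'M[R]_n) (lam : 'rV[R]_n)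
    (i0 : 'I_n) (c : R) : c != 0 -> orthogonal_matrix Q ->
  (forall i, Q i i0 = c) ->
  forall i, \sum_j (Q *m diag_mx lam *m Q^T) i j = lam 0 i0.
Proof.
move=> nz_c orthQ col0 i.
have colsum k : \sum_j Q j k = c^-1 *+ (i0 == k).
  have /matrixP/(_ i0 k) := orthQ; rewrite !mxE => sumQ.
  apply: (mulfI nz_c); rewrite mulrnAr mulfV // -sumQ mulr_sumr.
  by apply: eq_bigr => j _; rewrite mxE col0.
under eq_bigr do rewrite spectralE.
rewrite exchange_big /=.
transitivity (\sum_k Q i k * lam 0 k * (c^-1 *+ (i0 == k))).
  by apply: eq_bigr => k _; rewrite -colsum mulr_sumr;
     apply: eq_bigr => j _; rewrite mulrAC.
rewrite (bigD1 i0) //= eqxx col0 mulr1n mulrAC mulfV // mul1r big1 ?addr0 //.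
by move=> k; rewrite eq_sym => /negbTE ->; rewrite mulr0.
Qed.

(** Since $|Q_{ik} Q_{jk}| = c^2$ and $\lambda_k \le 0$ off the column [i0],
    where the product is exactly $c^2$, each entry is at least $c^2 \sum_k \lambda_k$. *)
Lemma spectral_ge0 (R : realDomainType) (n : nat) (Q : 'M[R]_n)
    (lam : 'rV[R]_n) (i0 : 'I_n) (c : R) :
  (forall i j, `|Q i j| = c) -> (forall i, Q i i0 = c) ->
  (forall k, k != i0 -> lam 0 k <= 0) -> 0 <= \sum_k lam 0 k ->
  forall i j, 0 <= (Q *m diag_mx lam *m Q^T) i j.
Proof.
move=> normQ col0 lam_le0 sum_ge0 i j; rewrite spectralE.
apply: (@le_trans _ _ (c * c * \sum_k lam 0 k)).
  by rewrite mulr_ge0 // -expr2 sqr_ge0.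
rewrite mulr_sumr; apply: ler_sum => k _.
have [->|neq_k] := eqVneq k i0; first by rewrite !col0.
rewrite ler_wnM2r ?lam_le0 //.
by apply: le_trans (ler_norm _) _; rewrite normrM !normQ.
Qed.

(** * Symmetric doubly stochastic matrices with a given spectrum *)

Theorem theorem11 (R : realType) (d : nat) (hd : (1 <= d)%N) :
  let n := (2 ^ d)%N in
  normalisation_of (sylvester R d) (sylvester R d) /\
  forall H : 'M[R]_n, normalisation_of (sylvester R d) H ->
    let Q : 'M[R]_n := (Num.sqrt n%:R)^-1 *: H in
    [/\ orthogonal_matrix Q,
        forall i j : 'I_n, j = 0%N :> nat -> Q i j = 1 / Num.sqrt n%:R,
        forall i j : 'I_n,
          Q i j = 1 / Num.sqrt n%:R \/ Q i j = - (1 / Num.sqrt n%:R),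
        coherence Q = 1
      & forall lam : 'rV[R]_n, suleimanova lam ->
          0 < 1 + \sum_(j < n | (0 < j)%N) lam 0 j ->
          (Q *m diag_mx lam *m Q^T)^T = Q *m diag_mx lam *m Q^T /\
          doubly_stochastic (Q *m diag_mx lam *m Q^T)].
Proof.
move=> n; split; first exact: sylvester_normalised.
move=> H normH Q; set c := (Num.sqrt n%:R)^-1.
have n_gt0 : (0 < n)%N by rewrite expn_gt0.
have n_gt1 : (1 < n)%N by rewrite -(expn0 2) ltn_exp2l.
have c_gt0 : 0 < c by rewrite invr_gt0 sqrtr_gt0 ltr0n.
have normQ i j : `|Q i j| = c.
  by rewrite mxE normrM (normalisation_norm1 normH) mulr1 gtr0_norm.
have col0 i (j : 'I_n) : j = 0%N :> nat -> Q i j = c.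
  by case: normH => _ H0 j0; rewrite mxE H0 // mulr1.
have orthQ : orthogonal_matrix Q.
  have orthH := normalisation_orthogonal normH (sylvester_orthogonal R d).
  rewrite /orthogonal_matrix /Q linearZ /= linearZ /= -scalemxAl orthH scalerA.
  rewrite scale_scalar_mx -invfM -expr2 sqr_sqrtr ?ler0n // mulVf //.
  by rewrite pnatr_eq0 -lt0n.
split=> //.
- by move=> i j j0; rewrite div1r col0.
- move=> i j; rewrite div1r -/c; have /eqP := normQ i j.
  by rewrite eqr_norml => /andP[/orP[/eqP|/eqP] ? _]; [left | right].
- exact: coherence_flat.
move=> lam [lam0 lam_neg] sum_gt0; split; first exact: spectral_sym.
pose i0 := Ordinal n_gt0.
have rows := row_sum_spectral lam (lt0r_neq0 c_gt0) orthQ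
  (fun i => col0 i i0 erefl).
split.
- apply: (@spectral_ge0 _ _ _ _ i0 c) => //.
  + by move=> i; apply: col0.
  + by move=> k; rewrite -val_eqE -lt0n /= => /lam_neg /andP[].
  + rewrite (bigD1 i0) //= lam0 // ltW //.
    by under eq_bigl do rewrite -val_eqE -lt0n.
- by move=> i; rewrite rows lam0.
- move=> j; rewrite -(lam0 i0) // -(rows j); apply: eq_bigr => i _.
  by rewrite -[in LHS]spectral_sym mxE.
Qed.
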